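(* Consider a hyperbolic system $\partial_tu+\nabla\cdot f(u)=0$ with convex invariant region $B\subset\mathbb R^m$, and suppose that it has the Lax–Friedrichs splitting property: $u\in B$ implies $u\pm a^{-1}f(u)\cdot\nu\in B$ for any unit vector $\nu$ and any $a>0$ with $a\ge\max|\mathrm{eig}(\partial_uf(u)\cdot\nu)|$. If $$\lambda a_0\le c_{\mathcal G},$$ then, for every cell $K$ and each choice of sign, $$u_h\in B\text{ on }S_K\quad\Longrightarrow\quad\overline{u_h\pm\Delta t\,\mathcal G(u_h)}_K\in B.$$
   Context: $f=[f_1,\dots,f_d]:B\to\mathbb R^{m\times d}$ is a $C^1$ flux. $\mathcal T_h=\{K\}$ is a mesh of $\Omega\subset\mathbb R^d$; each cell $K$ has flat edges $e_{\ell,K}$, $\ell=1,\dots,l(K)$, forming $\partial K$, with constant unit outer normals $\nu_{\ell,K}$ ($|e_{\ell,K}|:=1$ if $d=1$). $V_h=\{v\in L^2(\Omega): v|_K\in[Z^k(K)]^m\ \forall K\}$, where $k\ge1$ and $Z^k(K)$ is the space of polynomials of total degree $\le k$, or of degree $\le k$ in each variable; $u_h\in V_h$, $u_h^{\rm int}$ is the interior trace on $e_{\ell,K}$, and $\overline v_K=\frac1{|K|}\int_Kv\,dx$. Quadrature: edge integrals are replaced by $\int_{e_{\ell,K}}v\,dl\approx|e_{\ell,K}|\sum_{\beta=1}^{s_\ell}\omega^{\rm B}_{\beta,\ell,K}v(x_{\beta,\ell,K})$ with $\omega^{\rm B}_{\beta,\ell,K}>0$ and $\sum_\beta\omega^{\rm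 B}_{\beta,\ell,K}=1$. There is a convex decomposition, valid for all $v\in Z^k(K)$: $\overline v_K=\sum_{\alpha=1}^{s_K}\omega^{\rm I}_{\alpha,K}v(x_{\alpha,K})+\sum_{\ell=1}^{l(K)}\sum_{\beta=1}^{s_\ell}\omega^{\rm I}_{\beta,\ell,K}v(x_{\beta,\ell,K})$ with all weights in $(0,1)$ (hence summing to 1). $S_K=\{x_{\alpha,K},x_{\beta,\ell,K}\}$; ''$u_h\in B$ on $S_K$'' means $u_h(x_{\alpha,K})\in B$ and $u_h^{\rm int}(x_{\beta,\ell,K})\in B$ for all $\alpha,\beta,\ell$. Local derivative operator: $\mathcal G(u_h)=-\nabla^{\rm loc}\cdot f(u_h)\in V_h$, where for all $v_h\in V_h$, $\int_K[\nabla^{\rm loc}\cdot f(u_h)]\cdot v_h\,dx=-\int_Kf(u_h):\nabla v_h\,dx+\sum_\ell\int_{e_{\ell,K}}(f(u_h^{\rm int})\cdot\nu_{\ell,K})\cdot v_h\,dl$ with edge integrals computed by the quadrature above (''$:$'' is the Frobenius inner product). Constants: $\Delta t>0$; $\lambda=\max_{\ell,K}\Delta t\,|e_{\ell,K}|/|K|$; $a_0=\max|\mathrm{eig}(\partial_uf(u_h)\cdot\nu_{\ell,K})|>0$, the maximum over all $\ell,K$ and all values of $u_h$ (including its interior traces at the points $x_{\beta,\ell,K}$); $c_{\mathcal G}=\min_{\beta,\ell,K}\omega^{\rm I}_{\beta,\ell,K}/\omega^{\rm B}_{\beta,\ell,K}$. *)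

(* Defs.v *)
From HB Require Import structures.
From mathcomp Require Import all_boot all_order all_algebra.
From mathcomp Require Import -(notations) mpoly.
From mathcomp Require Import all_classical all_reals all_analysis.
Set Implicit Arguments. Unset Strict Implicit. Unset Printing Implicit Defensive.
Import Order.TTheory GRing.Theory Num.Theory.
Import numFieldNormedType.Exports.
Local Open Scope classical_set_scope.
Local Open Scope ring_scope.

(* Lebesgue measure on R^n: the library has it on R, and products of two
   measures; [n.-tuple R] carries the product sigma-algebra. *)
Section lebesgue_step.
Context {R : realType} {n : nat}.
Local Notation RT := (measurableTypeR R).

Definition tcons (p : RT * n.-tuple RT) : n.+1.-tuple RT :=
  [tuple of p.1 :: p.2].
Definition tuncons (t : n.+1.-tuple RT) : RT * n.-tuple RT :=
  (thead t, [tuple of behead t]).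

Lemma tconsK : cancel tcons tuncons.
Proof. by case=> x t; rewrite /tuncons theadE; congr pair; exact: val_inj. Qed.

Lemma tunconsK : cancel tuncons tcons.
Proof. by move=> t; rewrite [RHS]tuple_eta. Qed.

Lemma measurable_tcons : measurable_fun [set: RT * n.-tuple RT] tcons.
Proof. exact: (measurable_cons measurable_fst measurable_snd). Qed.

Lemma measurable_tuncons : measurable_fun [set: n.+1.-tuple RT] tuncons.
Proof.
apply/measurable_fun_pairP; split; [exact: measurable_tnth|exact: measurable_behead].
Qed.

Variable mu : {sigma_finite_measure set (n.-tuple RT) -> \bar R}.

Definition lebesgue_step : set (n.+1.-tuple RT) -> \bar R :=
  pushforward (@lebesgue_measure R \x mu)%E tcons.

Let lebesgue_step0 : lebesgue_step set0 = 0%E.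
Proof. by rewrite /lebesgue_step /pushforward preimage_set0 measure0. Qed.

Let lebesgue_step_ge0 A : (0 <= lebesgue_step A)%E.
Proof. exact: (measure_ge0 (@lebesgue_measure R \x mu)%E). Qed.

Let lebesgue_step_sigma_additive : semi_sigma_additive lebesgue_step.
Proof.
move=> F mF tF mUF; rewrite /lebesgue_step /pushforward preimage_bigcup.
apply: (@measure_semi_sigma_additive _ _ _ (@lebesgue_measure R \x mu)%E).
- by move=> i; rewrite -[X in measurable X]setTI; exact: measurable_tcons.
- apply/trivIsetP => /= i j _ _ ij; rewrite -preimage_setI.
  by move/trivIsetP : tF => /(_ _ _ _ _ ij) ->//; rewrite preimage_set0.
- by rewrite -preimage_bigcup -[X in measurable X]setTI; exact: measurable_tcons.
Qed.
HB.instance Definition _ := isMeasure.Build _ _ _ lebesgue_step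
  lebesgue_step0 lebesgue_step_ge0 lebesgue_step_sigma_additive.

Let lebesgue_step_sigma_finite : sigma_finite setT lebesgue_step.
Proof.
have /sigma_finiteP[F [TF ndF Foo]] := sigma_finiteT (@lebesgue_measure R).
have /sigma_finiteP[G [TG ndG Goo]] := sigma_finiteT mu.
exists (fun i => tuncons @^-1` (F i `*` G i)) => [|i].
  rewrite -preimage_bigcup -[LHS](preimage_setT tuncons); congr (_ @^-1` _).
  rewrite -setXTT TF TG predeqE => -[x y]; split=> [|[i _ []/= ? ?]]; last first.
    by split; exists i.
  move=> [/= [i _ Fix] [j _ Gjy]]; exists (maxn i j) => //; split.
  - by move: x Fix; exact/subsetPset/ndF/leq_maxl.
  - by move: y Gjy; exact/subsetPset/ndG/leq_maxr.
have [mF Flt] := Foo i; have [mG Glt] := Goo i; split.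
  rewrite -[X in measurable X]setTI; apply: measurable_tuncons => //.
  exact: measurableX.
rewrite /lebesgue_step /pushforward -comp_preimage.
rewrite (_ : _ \o _ = id) ?preimage_id; last exact/funext/tconsK.
by rewrite product_measure1E// lte_mul_pinfty// ge0_fin_numE.
Qed.

HB.instance Definition _ := Measure_isSigmaFinite.Build _ _ _ lebesgue_step
  lebesgue_step_sigma_finite.

End lebesgue_step.

Fixpoint lebesgue_tuple (R : realType) (n : nat) :
    {sigma_finite_measure set (n.-tuple (measurableTypeR R)) -> \bar R} :=
  match n with
  | 0 => \d_([tuple] : 0.-tuple (measurableTypeR R))
  | n'.+1 => lebesgue_step (lebesgue_tuple R n')
  end.

Lemma lebesgue_tuple_box (R : realType) (n : nat) (A : 'I_n -> set R) :
  (forall i, measurable (A i : set (measurableTypeR R))) ->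
  lebesgue_tuple R n [set t | forall i, A i (tnth t i)] =
  (\prod_(i < n) lebesgue_measure (A i : set (measurableTypeR R)))%E.
Proof.
elim: n A => [|n IH] A mA.
  by rewrite big_ord0 /= diracE mem_set// => -[].
have mbox : measurable [set t : n.-tuple (measurableTypeR R) |
    forall i, A (lift ord0 i) (tnth t i)].
  rewrite (_ : [set _ | _] =
      \bigcap_(i in [set: 'I_n]) ((@tnth _ _)^~ i) @^-1` A (lift ord0 i)).
    apply: fin_bigcap_measurable => // i _.
    rewrite -[X in measurable X]setTI; exact: measurable_tnth.
  by apply/seteqP; split=> t /= h i; [move=> _|]; exact: h.
rewrite big_ord_recl -IH// -product_measure1E//=.
rewrite /lebesgue_step /pushforward; congr (_ _).
apply/seteqP; split=> -[x t] /= h.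
  by split=> [|i]; [have := h ord0|have := h (lift ord0 i); rewrite tnthS].
case: h => h0 h i; case: (unliftP ord0 i) => [j|] ->; last exact: h0.
by rewrite tnthS; exact: h.
Qed.

(* Points of R^d and states in R^m are row vectors.  Their library norm is the
   sup norm, so the Euclidean structure is spelled out through [dot]; only the
   topology of the library norm is used. *)
Section euclidean.
Context {R : realType} {d : nat}.

Definition point (t : d.-tuple (measurableTypeR R)) : 'rV[R]_d :=
  \row_i tnth t i.

Definition volume (A : set 'rV[R]_d) : R :=
  fine (lebesgue_tuple R d (point @^-1` A)).

Definition integral_over (A : set 'rV[R]_d) (g : 'rV[R]_d -> R) : R :=
  \int[lebesgue_tuple R d]_(t in point @^-1` A) g (point t).

Definition dot (x y : 'rV[R]_d) : R := \sum_i x 0 i * y 0 i.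

Definition unit_vector (nu : 'rV[R]_d) : Prop := dot nu nu = 1.

(* (d-1)-dimensional measure of a set e lying in a hyperplane with unit normal
   nu: the volume of the right prism of height 1 over e.  For d = 1 and e a
   point this is the length of a unit segment, i.e. 1. *)
Definition flat_measure (nu : 'rV[R]_d) (e : set 'rV[R]_d) : R :=
  volume [set y | exists x s, [/\ e x, 0 <= s <= 1 & y = x + s *: nu]].

(* Interior of e relative to the hyperplane through the point, normal to nu. *)
Definition flat_interior (nu : 'rV[R]_d) (e : set 'rV[R]_d) : set 'rV[R]_d :=
  [set x | e x /\ \forall y \near x, dot (y - x) nu = 0 -> e y].

End euclidean.

Section extrema.
Context {R : realType}.

Definition is_max (S : set R) (a : R) : Prop := S a /\ ubound S a.
Definition is_min (S : set R) (a : R) : Prop := S a /\ lbound S a.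

End extrema.

Section mesh.
Context {R : realType} {d : nat}.

Record cell := Cell {
  cell_set : set 'rV[R]_d;
  nedges : nat;
  edge : 'I_nedges -> set 'rV[R]_d;
  normal : 'I_nedges -> 'rV[R]_d }.

(* A flat edge e with unit normal nu; e is regular in its hyperplane, so that
   it has no lower-dimensional parts. *)
Definition flat_edge (nu : 'rV[R]_d) (e : set 'rV[R]_d) : Prop :=
  [/\ unit_vector nu, e !=set0,
      forall x y, e x -> e y -> dot (x - y) nu = 0 &
      closure (flat_interior nu e) = e].

Definition outer_normal (K : set 'rV[R]_d) (nu : 'rV[R]_d)
    (e : set 'rV[R]_d) : Prop :=
  forall x, flat_interior nu e x ->
    \forall s \near 0^'+, ~ K (x + s *: nu) /\ interior K (x - s *: nu).

Definition polytopal_cell (K : cell) : Prop :=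
  [/\ cell_set K !=set0 /\ compact (cell_set K),
      closure (interior (cell_set K)) = cell_set K,
      cell_set K `\` interior (cell_set K) =
        \bigcup_(l in [set: 'I_(nedges K)]) edge l,
      forall l : 'I_(nedges K), flat_edge (normal l) (edge l) /\
        outer_normal (cell_set K) (normal l) (edge l) &
      forall l l' : 'I_(nedges K), l != l' ->
        flat_interior (normal l) (edge l) `&`
        flat_interior (normal l') (edge l') = set0].

Definition is_mesh (Omega : set 'rV[R]_d) (N : nat) (T : 'I_N -> cell) : Prop :=
  [/\ forall K, polytopal_cell (T K),
      forall K K', K != K' ->
        interior (cell_set (T K)) `&` interior (cell_set (T K')) = set0 &
      \bigcup_(K in [set: 'I_N]) cell_set (T K) = closure Omega].

Definition edge_measure (K : cell) (l : 'I_(nedges K)) : R :=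
  flat_measure (normal l) (edge l).

Definition cell_mean (K : cell) (g : 'rV[R]_d -> R) : R :=
  integral_over (cell_set K) g / volume (cell_set K).

End mesh.
Arguments cell : clear implicits.

Section polynomials.
Context {R : realType} {d : nat}.

Definition peval (p : mpoly d R) (x : 'rV[R]_d) : R :=
  meval (fun i => x 0 i) p.

Variant degree_kind := TotalDegree | CoordinateDegree.

Definition polynomial_space (z : degree_kind) (k : nat) :
    set (mpoly d R) :=
  [set p | forall mu, mu \in msupp p ->
     match z return Prop with
     | TotalDegree => (mdeg mu <= k)%N
     | CoordinateDegree => forall i, (mu i <= k)%N
     end].

End polynomials.

Section quadrature.
Context {R : realType} {d : nat}.

(* Nodes and weights on a cell with L edges; s_edge l and s_int are the numbers
   of nodes, wB the weights of the edge rules, wI_int and wI_edge those of the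
   convex decomposition of the cell mean. *)
Record quadrature (L : nat) := Quadrature {
  s_edge : 'I_L -> nat;
  x_edge : forall l, 'I_(s_edge l) -> 'rV[R]_d;
  wB : forall l, 'I_(s_edge l) -> R;
  s_int : nat;
  x_int : 'I_s_int -> 'rV[R]_d;
  wI_int : 'I_s_int -> R;
  wI_edge : forall l, 'I_(s_edge l) -> R }.

Definition edge_rule (K : cell R d) (Q : quadrature (nedges K))
    (l : 'I_(nedges K)) (g : 'rV[R]_d -> R) : R :=
  edge_measure l * \sum_(b < s_edge Q l) wB b * g (x_edge b).

Definition valid_edge_rules (K : cell R d) (Q : quadrature (nedges K)) : Prop :=
  forall l, [/\ forall b : 'I_(s_edge Q l), edge l (x_edge b),
                forall b : 'I_(s_edge Q l), 0 < wB b &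
                \sum_(b < s_edge Q l) wB b = 1].

Definition convex_decomposition (K : cell R d) (Q : quadrature (nedges K))
    (Z : set (mpoly d R)) : Prop :=
  [/\ forall a : 'I_(s_int Q), cell_set K (x_int a),
      forall a : 'I_(s_int Q), 0 < wI_int a < 1,
      forall l (b : 'I_(s_edge Q l)), 0 < wI_edge b < 1 &
      forall p, Z p ->
        cell_mean K (peval p) =
          \sum_(a < s_int Q) wI_int a * peval p (x_int a) +
          \sum_(l < nedges K) \sum_(b < s_edge Q l)
            wI_edge b * peval p (x_edge b)].

End quadrature.
Arguments quadrature : clear implicits.

Section conservation_law.
Context {R : realType} {d m : nat}.
Implicit Types (f : 'rV[R]_m -> 'M[R]_(m, d)) (B : set 'rV[R]_m).

(* f(u) . nu, as a row vector.  f is a total function; only its values near B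
   are subject to hypotheses. *)
Definition normal_flux f (nu : 'rV[R]_d) (u : 'rV[R]_m) : 'rV[R]_m :=
  (f u *m nu^T)^T.

Definition C1_flux B f : Prop :=
  exists U : set 'rV[R]_m,
    [/\ open U, B `<=` U, forall u, U u -> differentiable f u &
        forall v, {in U, continuous (fun u => 'D_v f u)}].

Definition hyperbolic B f : Prop :=
  forall u nu, B u -> unit_vector nu ->
    diagonalizable ('J (normal_flux f nu) u).

(* |eig(d_u f(u) . nu)|.  The library Jacobian is the transpose of the usual
   one, which has the same eigenvalues. *)
Definition abs_eig f (nu : 'rV[R]_d) (u : 'rV[R]_m) : set R :=
  [set `|z| | z in [set z | eigenvalue ('J (normal_flux f nu) u) z]].

Definition LF_splitting B f : Prop :=
  forall u nu a, B u -> unit_vector nu -> 0 < a -> ubound (abs_eig f nu u) a ->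
    B (u + a^-1 *: normal_flux f nu u) /\ B (u - a^-1 *: normal_flux f nu u).

(* Test functions: C^1 on R x R^d, with compact support in R x Omega. *)
Definition test_function (Omega : set 'rV[R]_d) (phi : R * 'rV[R]_d -> R) :
    Prop :=
  [/\ forall z, differentiable phi z,
      forall v, continuous (fun z => 'D_v phi z) &
      exists2 C : set (R * 'rV[R]_d),
        compact C /\ C `<=` [set z | interior Omega z.2] &
        forall z, ~ C z -> phi z = 0].

(* Weak solutions of d_t u + div f(u) = 0 in [0, +oo[ x Omega, with initial
   datum u 0. *)
Definition weak_solution f (Omega : set 'rV[R]_d) :
    set (R -> 'rV[R]_d -> 'rV[R]_m) :=
  [set u : R -> 'rV[R]_d -> 'rV[R]_m |
    forall phi, test_function Omega phi -> forall i : 'I_m,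
    let mu := (@lebesgue_measure R \x lebesgue_tuple R d)%E in
    let D := [set p : measurableTypeR R * d.-tuple (measurableTypeR R) |
                0 <= p.1 /\ interior Omega (point p.2)] in
    let g := fun p : measurableTypeR R * d.-tuple (measurableTypeR R) =>
      let z : R * 'rV[R]_d := (p.1, point p.2) in
      u z.1 z.2 0 i * 'D_(1, 0) phi z +
      \sum_(j < d) f (u z.1 z.2) i j * 'D_(0, delta_mx 0 j) phi z in
    let D0 := point @^-1` interior Omega in
    let g0 := fun t => u 0 (point t) 0 i * phi (0, point t) in
    [/\ mu.-integrable D (EFin \o g),
        (lebesgue_tuple R d).-integrable D0 (EFin \o g0) &
        \int[mu]_(p in D) g p + \int[lebesgue_tuple R d]_(t in D0) g0 t = 0]].

(* B is invariant for a class sol of solutions: data in B stay in B. *)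
Definition invariant_region (Omega : set 'rV[R]_d)
    (sol : set (R -> 'rV[R]_d -> 'rV[R]_m)) B : Prop :=
  forall u, sol u ->
    {ae lebesgue_tuple R d, forall t, Omega (point t) -> B (u 0 (point t))} ->
    {ae (@lebesgue_measure R \x lebesgue_tuple R d)%E,
      forall p, 0 <= p.1 -> Omega (point p.2) -> B (u p.1 (point p.2))}.

End conservation_law.

Section discontinuous_galerkin.
Context {R : realType} {d m N : nat}.
Variables (T : 'I_N -> cell R d) (Q : forall K, quadrature R d (nedges (T K))).
Variables (Z : 'I_N -> set (mpoly d R)).

(* A piecewise polynomial v is given by its restrictions v|_K, the components
   of which are the polynomials v K i.  Its interior trace on an edge of K is
   then the value of v|_K there. *)
Definition dg_function := 'I_N -> 'I_m -> mpoly d R.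

Definition dg_space : set dg_function := [set v | forall K i, Z K (v K i)].

Definition dg_eval (v : dg_function) (K : 'I_N) (x : 'rV[R]_d) : 'rV[R]_m :=
  \row_i peval (v K i) x.

Definition dg_mean (v : dg_function) (K : 'I_N) : 'rV[R]_m :=
  \row_i cell_mean (T K) (peval (v K i)).

Definition local_divergence (f : 'rV[R]_m -> 'M[R]_(m, d))
    (u w : dg_function) : Prop :=
  dg_space w /\
  forall v, dg_space v -> forall K,
    integral_over (cell_set (T K)) (fun x => dot (dg_eval w K x) (dg_eval v K x)) =
    - integral_over (cell_set (T K)) (fun x => \sum_(i < m) \sum_(j < d)
         f (dg_eval u K x) i j * peval (mderiv j (v K i)) x) +
    \sum_(l < nedges (T K)) edge_rule (Q K) l (fun x =>
       dot (normal_flux f (normal l) (dg_eval u K x)) (dg_eval v K x)).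

(* G(u) = - div^loc f(u); u determines it uniquely, so it is given as a
   relation between u and G. *)
Definition local_derivative f (u G : dg_function) : Prop :=
  exists2 w, local_divergence f u w & forall K i, G K i = - w K i.

Definition in_on_nodes (B : set 'rV[R]_m) (u : dg_function) (K : 'I_N) : Prop :=
  (forall a : 'I_(s_int (Q K)), B (dg_eval u K (x_int a))) /\
  (forall l (b : 'I_(s_edge (Q K) l)), B (dg_eval u K (x_edge b))).

Definition courant_ratios (dt : R) : set R :=
  [set z | exists K (l : 'I_(nedges (T K))),
     z = dt * edge_measure l / volume (cell_set (T K))].

Definition wave_speeds f (u : dg_function) : set R :=
  [set z | exists K (l : 'I_(nedges (T K))) K' x,
     cell_set (T K') x /\ abs_eig f (normal l) (dg_eval u K' x) z].

Definition weight_ratios : set R :=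
  [set z | exists K l (b : 'I_(s_edge (Q K) l)), z = wI_edge b / wB b].

End discontinuous_galerkin.
Arguments dg_function : clear implicits.

(* Main.v *)
(* Testing the local divergence against constants expresses the mean of G as a
   quadrature of the fluxes over the boundary nodes.  The convex decomposition
   writes the mean of u as a convex combination of nodal values containing the
   same boundary nodes, so the updated mean is a convex combination of interior
   values of u and of boundary states u + q f(u).nu.  The CFL condition gives
   |q| a0 <= 1, whence the Lax-Friedrichs splitting puts these states in B.
   Applying the decomposition to polynomials rather than integrating them means
   that only the constant 1 has to be integrated: its mean is 1, because a cell
   is measurable with finite positive volume. *)
Require Import Defs.
From mathcomp Require Import all_boot all_order all_algebra.
From mathcomp Require Import -(notations) mpoly.
From mathcomp Require Import finmap ring.
From mathcomp Require Import all_classical all_reals all_analysis.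
Set Implicit Arguments. Unset Strict Implicit. Unset Printing Implicit Defensive.
Import Order.TTheory GRing.Theory Num.Theory.
Import numFieldNormedType.Exports.
Local Open Scope classical_set_scope.
Local Open Scope ring_scope.

(** * Measure and volume of balls, compact sets and cells *)

Section geometry.
Context {R : realType} {d : nat}.
Implicit Types (A : set 'rV[R]_d) (x : 'rV[R]_d) (e : R).
Local Notation point := (@Defs.point R d).

(** The norm is the sup norm, so a ball is a box of intervals; this makes it measurable with
    explicit volume. *)
Lemma point_ballE x e : 0 < e ->
  point @^-1` ball x e =
  [set t | forall i, (ball (x 0 i) e : set (measurableTypeR R)) (tnth t i)].
Proof.
move=> e0; apply/seteqP; split=> t /=.
  by move=> [_ h] i; have := h 0 i; rewrite mxE.
by move=> h; split=> // i j; rewrite ord1 mxE; exact: h.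
Qed.

Lemma measurable_point_ball x e : 0 < e ->
  measurable (point @^-1` ball x e).
Proof.
move=> e0; rewrite point_ballE//.
rewrite (_ : [set _ | _] = \bigcap_(i in [set: 'I_d])
    ((@tnth _ _)^~ i) @^-1` (ball (x 0 i) e : set (measurableTypeR R))).
  apply: fin_bigcap_measurable => // i _.
  rewrite -[X in measurable X]setTI; apply: measurable_tnth => //.
  exact: measurable_realfun.measurable_ball.
by apply/seteqP; split=> t /= h i; [move=> _|]; exact: h.
Qed.

Lemma lebesgue_tuple_ball x e : 0 < e ->
  lebesgue_tuple R d (point @^-1` ball x e) = ((e *+ 2) ^+ d)%:E.
Proof.
move=> e0; rewrite point_ballE//.
rewrite (lebesgue_tuple_box (A := fun i => ball (x 0 i) e)); last first.
  by move=> i; exact: measurable_realfun.measurable_ball.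
under eq_bigr do rewrite lebesgue_measure_ball ?ltW//.
by rewrite prodEFin prodr_const card_ord.
Qed.

(** For each [n], [A] is covered by finitely many balls of radius [1/(n+1)] centred in [A]; the
    intersection over [n] of these finite unions is [A]. *)
Lemma measurable_point_compact A : compact A ->
  measurable (point @^-1` A).
Proof.
move=> cA.
have e_gt0 n : 0 < n.+1%:R^-1 :> R by rewrite invr_gt0.
have /choice[D hD] n : exists D : set 'rV[R]_d,
    [/\ finite_set D, D `<=` A & A `<=` \bigcup_(x in D) ball x n.+1%:R^-1].
  move: cA; rewrite compact_cover => /(_ _ A (fun x => ball x n.+1%:R^-1)).
  case=> [x _|x Ax|D' sD AD]; first exact: ball_open.
    by exists x => //; exact: ballxx.
  exists [set` D']; split => //.
  by move=> x /= /sD; rewrite inE.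
rewrite (_ : _ @^-1` _ = \bigcap_n \bigcup_(x in D n)
    point @^-1` ball x n.+1%:R^-1).
  apply: bigcapT_measurable => n; have [fD _ _] := hD n.
  by apply: fin_bigcup_measurable => // x _; exact: measurable_point_ball.
apply/seteqP; split=> t /=.
  by move=> At n _; have [_ _ /(_ _ At)[x ? ?]] := hD n; exists x.
(* A point of the intersection is within [1/(n+1)] of [A] for every [n], hence in the closure of
   [A]. *)
move=> h; have : closed A by apply: compact_closed => //; exact: norm_hausdorff.
apply => V /nbhs_ballP[e /= e0 eV].
have [n ne] : exists n, n.+1%:R^-1 < e.
  have /= [n _ hn] := num_normedtype.near_infty_natSinv_lt (PosNum e0).
  by exists n; apply: hn => /=.
have [x xD xt] := h n I.
exists x; split; first by have [_ + _] := hD n; exact.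
by apply: eV; apply: ball_sym; apply: le_ball xt; exact: ltW.
Qed.

Lemma lebesgue_tuple_compact_lty A : compact A ->
  (lebesgue_tuple R d (point @^-1` A) < +oo)%E.
Proof.
move=> cA; have [M [_ /(_ (`|M| + 1))]] := compact_bounded cA.
have M1 : 0 < `|M| + 1 by rewrite ltr_wpDl.
case/(_ _)/Wrap; first by rewrite (le_lt_trans (ler_norm _))// ltrDl.
move=> /= AM.
(* Points of [A] have norm at most [|M| + 1]; the ball is open, so its radius is one larger. *)
apply: (@le_lt_trans _ _ (lebesgue_tuple R d (point @^-1` ball (0 : 'rV[R]_d) (`|M| + 2)))).
  apply: le_measure; rewrite ?inE.
  - exact: measurable_point_compact.
  - by apply: measurable_point_ball; rewrite ltr_wpDl.
  - move=> t /= /AM; rewrite -ball_normE /= sub0r normrN => /le_lt_trans; apply.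
    by rewrite ltrD2l ltr1n.
by rewrite lebesgue_tuple_ball ?ltry// ltr_wpDl.
Qed.

Lemma volume_compact_gt0 A : compact A -> interior A !=set0 -> 0 < volume A.
Proof.
move=> cA [x /nbhs_ballP[e /= e0 eA]].
(* [fine] sends [+oo] to 0, so positivity also requires finite measure. *)
rewrite /volume fine_gt0// lebesgue_tuple_compact_lty// andbT.
apply: (@lt_le_trans _ _ (lebesgue_tuple R d (point @^-1` ball x e))).
  by rewrite lebesgue_tuple_ball// lte_fin exprn_gt0// pmulrn_lgt0.
apply: le_measure; rewrite ?inE.
- exact: measurable_point_ball.
- exact: measurable_point_compact.
- by move=> t /= /eA.
Qed.

Lemma volume_ge0 A : 0 <= volume A.
Proof. by rewrite fine_ge0. Qed.

Lemma cell_mean1 (K : cell R d) : polytopal_cell K ->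
  cell_mean K (peval (mpolyC d 1)) = 1.
Proof.
case=> -[K0 cK] cl _ _ _.
(* The cell is the closure of its interior, so an empty interior would make it empty. *)
have ri : interior (cell_set K) !=set0.
  apply/set0P/eqP => i0; move: K0; rewrite -cl i0 closure0.
  by case.
have v0 := volume_compact_gt0 cK ri.
rewrite /cell_mean /integral_over.
under eq_Rintegral do rewrite /peval mevalC.
rewrite Rintegral_cst; last exact: measurable_point_compact.
by rewrite mul1r divff// gt_eqF.
Qed.

End geometry.

(** * Polynomial spaces and finite convex combinations *)

Lemma polynomial_space1 (R : realType) (d k : nat) (z : degree_kind) :
  polynomial_space z k (mpolyC d (1 : R)).
Proof.
move=> mu; rewrite msupp1 inE => /eqP ->.
by case: z => [|i]; rewrite ?mdeg0 ?mnm0E.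
Qed.

Lemma polynomial_space_subZ (R : realType) (d k : nat) (z : degree_kind)
    (p q : mpoly d R) (s : R) :
  polynomial_space z k p -> polynomial_space z k q ->
  polynomial_space z k (p - s *: q).
Proof.
move=> hp hq mu /msuppB_le; rewrite mem_cat => /orP[|/msuppZ_le]; [exact: hp|exact: hq].
Qed.

Lemma convex_set_sum (R : realType) (V : lmodType R) (B : set V)
    (I : Type) (r : seq I) (w : I -> R) (x : I -> V) :
  convex_set B -> (forall i, 0 < w i) -> (forall i, B (x i)) ->
  \sum_(i <- r) w i = 1 -> B (\sum_(i <- r) w i *: x i).
Proof.
move=> cB w0 Bx.
have sum_gt0 (i : I) (s : seq I) : 0 < \sum_(j <- i :: s) w j.
  rewrite big_cons ltr_pwDl// sumr_ge0// => j _; exact: ltW.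
(* Dividing by the total weight lets the induction run on lists whose weights do not sum to 1;
   positivity of a nonempty sum makes the division legitimate. *)
suff main (i : I) s : B ((\sum_(j <- i :: s) w j)^-1 *:
    \sum_(j <- i :: s) w j *: x j).
  case: r => [|i s] w1; first by move: w1; rewrite big_nil => /eqP; rewrite eq_sym oner_eq0.
  by have := main i s; rewrite w1 invr1 scale1r.
elim: s i => [|j s IH] i.
  by rewrite !big_seq1 scalerA mulVf ?gt_eqF// scale1r.
have W0 := sum_gt0 i (j :: s); have W'0 := sum_gt0 j s.
have := IH j; move: W0 W'0; rewrite ![\sum_(_ <- i :: _) _]big_cons.
set W' := \sum_(_ <- _) _; set S := \sum_(_ <- _) _ => W0 W'0 BS.
(* The average splits into its head, with weight [t = w i / (w i + W')], and the average of the
   tail, with weight [1 - t]. *)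
have t01 : 0 <= w i / (w i + W') <= 1.
  by apply/andP; split; [rewrite divr_ge0// ltW|rewrite ler_pdivrMr// mul1r lerDl ltW].
have := cB (x i) (W'^-1 *: S) (Itv01 (andP t01).1 (andP t01).2).
rewrite !inE => /(_ (Bx i) BS).
congr (B _); rewrite /conv /= scalerDr !scalerA; congr (_ *: _ + _ *: _).
  by rewrite mulrC.
by rewrite /unstable.onem; field; rewrite !gt_eqF.
Qed.

(** * Cell means as sums over quadrature nodes *)

Section scheme.
Context {R : realType} {d m N : nat}.
Variables (T : 'I_N -> cell R d) (Q : forall K, quadrature R d (nedges (T K))).
Variables (k : nat) (z : 'I_N -> degree_kind).
Local Notation Z := (fun K => polynomial_space (z K) k).
Hypothesis hT : forall K, polytopal_cell (T K).
Hypothesis hI : forall K, convex_decomposition (Q K) (Z K).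

Lemma dg_mean_nodes (v : dg_function R d m N) (K : 'I_N) : dg_space Z v ->
  dg_mean T v K =
    \sum_(a < s_int (Q K)) wI_int a *: dg_eval v K (x_int a) +
    \sum_(l < nedges (T K)) \sum_(b < s_edge (Q K) l)
      wI_edge b *: dg_eval v K (x_edge b).
Proof.
move=> hv; apply/rowP => i; rewrite !mxE !summxE.
have [_ _ _ ->] := hI K; last exact: hv.
congr (_ + _); first by apply: eq_bigr => a _; rewrite !mxE.
apply: eq_bigr => l _; rewrite summxE.
by apply: eq_bigr => b _; rewrite !mxE.
Qed.

Lemma node_weights_sum (K : 'I_N) :
  \sum_(a < s_int (Q K)) wI_int a +
  \sum_(l < nedges (T K)) \sum_(b < s_edge (Q K) l) @wI_edge _ _ _ (Q K) l b = 1.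
Proof.
have [_ _ _ /(_ _ (@polynomial_space1 R d k (z K)))] := hI K.
rewrite (cell_mean1 (hT K)) => ->.
congr (_ + _); first by apply: eq_bigr => a _; rewrite /peval mevalC mulr1.
by apply: eq_bigr => l _; apply: eq_bigr => b _; rewrite /peval mevalC mulr1.
Qed.

(** Linearity is read off the nodal formula, where it is linearity of evaluation. *)
Lemma dg_mean_subZ (v w : dg_function R d m N) (s : R) (K : 'I_N) :
  dg_space Z v -> dg_space Z w ->
  dg_mean T (fun K i => v K i - s *: w K i) K =
  dg_mean T v K - s *: dg_mean T w K.
Proof.
move=> hv hw.
have eval_sub x : dg_eval (fun K i => v K i - s *: w K i) K x =
    dg_eval v K x - s *: dg_eval w K x.
  by apply/rowP => i; rewrite !mxE /peval mevalB mevalZ.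
rewrite !dg_mean_nodes//; last by move=> K' i; exact: polynomial_space_subZ.
rewrite scalerDr opprD addrACA !scaler_sumr; congr (_ + _).
  rewrite -sumrB; apply: eq_bigr => a _.
  by rewrite eval_sub scalerBr !scalerA mulrC.
rewrite -sumrB; apply: eq_bigr => l _.
rewrite scaler_sumr -sumrB; apply: eq_bigr => b _.
by rewrite eval_sub scalerBr !scalerA mulrC.
Qed.

Lemma dg_mean_local_divergence (f : 'rV[R]_m -> 'M[R]_(m, d))
    (u w : dg_function R d m N) (K : 'I_N) :
  local_divergence Q Z f u w ->
  dg_mean T w K = \sum_(l < nedges (T K)) \sum_(b < s_edge (Q K) l)
    (edge_measure l / volume (cell_set (T K)) * wB b) *:
      normal_flux f (normal l) (dg_eval u K (x_edge b)).
Proof.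
move=> [hw hdiv]; apply/rowP => i; rewrite mxE summxE.
(* Testing against the constant [i]-th unit vector extracts the [i]-th component. *)
pose e : dg_function R d m N := fun _ i' => mpolyC d (i' == i)%:R.
have he : dg_space Z e.
  move=> K' i'; rewrite /e; case: eqP => _; first exact: polynomial_space1.
  by move=> mu; rewrite msupp0.
have dot_e g x : dot g (dg_eval e K x) = g 0 i.
  rewrite /dot (bigD1 i)//= big1 => [|j /negPf ji]; rewrite !mxE /peval mevalC.
    by rewrite eqxx mulr1 addr0.
  by rewrite ji mulr0.
have := hdiv _ he K.
rewrite /cell_mean /integral_over.
under eq_Rintegral do rewrite dot_e mxE.
move=> ->.
(* The gradient of a constant vanishes, so only the edge terms remain. *)
under eq_Rintegral do (rewrite big1 => [|i' _]; [|rewrite big1// => j _;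
  rewrite mderivC /peval meval0 mulr0//]).
rewrite /Rintegral integral0 oppr0 add0r mulr_suml.
apply: eq_bigr => l _; rewrite summxE /edge_rule mulr_sumr mulr_suml.
by apply: eq_bigr => b _; rewrite dot_e !mxE; ring.
Qed.

End scheme.

(** * Lax-Friedrichs states and the convex splitting of the updated mean *)

Lemma LF_splitting_scale (R : realType) (d m : nat) (B : set 'rV[R]_m)
    (f : 'rV[R]_m -> 'M[R]_(m, d)) u nu (a q : R) :
  LF_splitting B f -> B u -> unit_vector nu -> ubound (abs_eig f nu u) a ->
  0 < a -> `|q| * a <= 1 -> B (u + q *: normal_flux f nu u).
Proof.
move=> hLF Bu nu1 ua a0 qa.
have [->|q0] := eqVneq q 0; first by rewrite scale0r addr0.
have q_gt0 : 0 < `|q| by rewrite normr_gt0.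
(* The splitting is applied with speed [1/|q|], which is at least [a]; its two signs cover both
   signs of [q]. *)
have [] := hLF u nu `|q|^-1 Bu nu1.
- by rewrite invr_gt0.
- move=> y /ua /le_trans; apply.
  by rewrite -[leRHS]mul1r ler_pdivlMr// mulrC.
rewrite invrK; case: (ger0P q) => _ //.
by rewrite scaleNr opprK.
Qed.

(** This gathers interior nodes and edge nodes, whose number depends on the edge, into one index
    type for [convex_set_sum]. *)
Lemma sum_sumType_sig (V : nmodType) (I J : finType) (P : J -> finType)
    (F : I + {j : J & P j} -> V) :
  \sum_n F n =
  \sum_i F (inl i) + \sum_j \sum_(b : P j) F (inr (existT _ j b)).
Proof.
rewrite big_sumType; congr (_ + _).
by rewrite [RHS](sig_big_dep _ _ (fun j b => F (inr (existT _ j b)))) /=;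
  apply: eq_bigr => -[].
Qed.

(** The signed step [s] treats both choices of sign at once, since the bound on the boundary states
    sees only [|s|]. *)
Lemma mean_sub_divergence_in (R : realType) (d m k N : nat)
    (T : 'I_N -> cell R d) (hT : forall K, polytopal_cell (T K))
    (z : 'I_N -> degree_kind)
    (Q : forall K, quadrature R d (nedges (T K)))
    (hB : forall K, valid_edge_rules (Q K))
    (hI : forall K, convex_decomposition (Q K) (polynomial_space (z K) k))
    (B : set 'rV[R]_m) (f : 'rV[R]_m -> 'M[R]_(m, d))
    (convexB : convex_set B) (hLF : LF_splitting B f)
    (u w : dg_function R d m N)
    (hu : dg_space (fun K => polynomial_space (z K) k) u)
    (hw : local_divergence Q (fun K => polynomial_space (z K) k) f u w)
    (dt lambda a0 cG s : R)
    (hlambda : ubound (courant_ratios T dt) lambda)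
    (ha0 : ubound (wave_speeds T f u) a0) (a0_gt0 : 0 < a0)
    (hcG : lbound (weight_ratios Q) cG)
    (hCFL : lambda * a0 <= cG) (hs : `|s| = dt) (K : 'I_N) :
  in_on_nodes Q B u K -> B (dg_mean T (fun K i => u K i - s *: w K i) K).
Proof.
move=> [Bint Bedge].
rewrite (dg_mean_subZ hI)//; last by case: hw.
rewrite (dg_mean_nodes hI)// (dg_mean_local_divergence _ hw).
have [_ wI0 wE0 _] := hI K.
pose V := volume (cell_set (T K)).
(* Factoring [wI_edge b] out of both the nodal value and the flux term leaves [q] as the flux
   coefficient. *)
pose q l b := - (s * (edge_measure l / V) * (wB b / @wI_edge _ _ _ (Q K) l b)).
pose x (n : 'I_(s_int (Q K)) + {l : 'I_(nedges (T K)) & 'I_(s_edge (Q K) l)}) :=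
  match n with
  | inl a => dg_eval u K (x_int a)
  | inr (existT l b) => dg_eval u K (x_edge b) +
      q l b *: normal_flux f (normal l) (dg_eval u K (x_edge b))
  end.
pose wt (n : 'I_(s_int (Q K)) + {l : 'I_(nedges (T K)) & 'I_(s_edge (Q K) l)}) :=
  match n with
  | inl a => wI_int a
  | inr (existT l b) => wI_edge b
  end.
rewrite [X in B X](_ : _ = \sum_n wt n *: x n); last first.
  rewrite sum_sumType_sig -addrA; congr (_ + _).
  rewrite scaler_sumr -sumrB; apply: eq_bigr => l _.
  rewrite scaler_sumr -sumrB; apply: eq_bigr => b _.
  rewrite scalerDr; congr (_ + _); rewrite !scalerA -scaleNr; congr (_ *: _).
  have /andP[w0 _] := wE0 l b.
  by rewrite /q mulrN; congr (- _); rewrite [RHS]mulrC -!mulrA mulVf ?gt_eqF// mulr1.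
apply: convex_set_sum => //.
- by move=> [a|[l b]] /=; [have /andP[] := wI0 a|have /andP[] := wE0 l b].
- move=> [a|[l b]] /=; first exact: Bint.
  have [_ _ bd /(_ l)[[nu1 _ _ _] _] _] := hT K.
  have [inE wB0 _] := hB K l.
  have /andP[w0 _] := wE0 l b; have {}wB0 := wB0 b.
  apply: (LF_splitting_scale hLF _ nu1 _ a0_gt0) => //.
    (* Edges lie in the cell, so the wave speed at an edge node is among those bounded by [a0]. *)
    move=> y hy; apply: ha0; exists K, l, K, (x_edge b); split => //.
    suff : (cell_set (T K) `\` interior (cell_set (T K))) (x_edge b) by case.
    by rewrite bd; exists l.
  have mu_ge0 : 0 <= edge_measure l / V by rewrite divr_ge0 ?volume_ge0.
  have ratio_gt0 : 0 < wB b / wI_edge b by rewrite divr_gt0.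
  rewrite normrN normrM normrM hs (ger0_norm mu_ge0) (gtr0_norm ratio_gt0).
  (* With [r = wB b / wI_edge b], the chain is [|q| * a0 <= lambda * a0 * r <= cG * r <= 1]. *)
  have hl : dt * (edge_measure l / V) <= lambda.
    by apply: hlambda; exists K, l; rewrite mulrA.
  have hc : cG <= wI_edge b / wB b by apply: hcG; exists K, l, b.
  have : dt * (edge_measure l / V) * a0 <= wI_edge b / wB b.
    by apply: le_trans hc; apply: le_trans hCFL; rewrite ler_pM2r.
  rewrite ler_pdivlMr// => h.
  by rewrite mulrA mulrAC ler_pdivrMr// mul1r mulrAC.
- by rewrite sum_sumType_sig -(node_weights_sum hT hI K).
Qed.

Theorem lemma3p3 (R : realType) (d m k N : nat)
    (hd : (0 < d)%N) (hm : (0 < m)%N) (hk : (1 <= k)%N)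
    (Omega : set 'rV[R]_d) (T : 'I_N -> cell R d) (hT : is_mesh Omega T)
    (z : 'I_N -> degree_kind)
    (Q : forall K, quadrature R d (nedges (T K)))
    (hB : forall K, valid_edge_rules (Q K))
    (hI : forall K, convex_decomposition (Q K) (polynomial_space (z K) k))
    (B : set 'rV[R]_m) (f : 'rV[R]_m -> 'M[R]_(m, d))
    (hf : C1_flux B f) (hyp : hyperbolic B f) (convexB : convex_set B)
    (sol : set (R -> 'rV[R]_d -> 'rV[R]_m))
    (hsol : sol `<=` weak_solution f Omega)
    (hinv : invariant_region Omega sol B)
    (hLF : LF_splitting B f)
    (u G : dg_function R d m N)
    (hu : dg_space (fun K => polynomial_space (z K) k) u)
    (hG : local_derivative Q (fun K => polynomial_space (z K) k) f u G)
    (dt lambda a0 cG : R) (hdt : 0 < dt)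
    (hlambda : is_max (courant_ratios T dt) lambda)
    (ha0 : is_max (wave_speeds T f u) a0) (a0_gt0 : 0 < a0)
    (hcG : is_min (weight_ratios Q) cG)
    (hCFL : lambda * a0 <= cG) :
  forall K : 'I_N, in_on_nodes Q B u K ->
    B (dg_mean T (fun K i => u K i + dt *: G K i) K) /\
    B (dg_mean T (fun K i => u K i - dt *: G K i) K).
Proof.
move=> K hK; have [w hw Gw] := hG.
have [hT1 _ _] := hT.
have main := mean_sub_divergence_in hT1 hB hI convexB hLF hu hw
  (proj2 hlambda) (proj2 ha0) a0_gt0 (proj2 hcG) hCFL _ hK.
(* As [G = - w], the two signs correspond to [s = dt] and [s = - dt]. *)
split.
- rewrite [X in dg_mean _ X](_ : _ = fun K i => u K i - dt *: w K i).
    by apply: main; rewrite gtr0_norm.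
  by apply/funext => K'; apply/funext => i; rewrite Gw scalerN.
- rewrite [X in dg_mean _ X](_ : _ = fun K i => u K i - (- dt) *: w K i).
    by apply: main; rewrite normrN gtr0_norm.
  by apply/funext => K'; apply/funext => i; rewrite Gw scalerN scaleNr.
Qed.
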